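(* Let $u\in[0,\pi/4]$. For $m$ a sum of two integer squares and $L>0$ let $\mathcal{Z}=\mathcal{Z}(m,L)$ be the number of zeroes of the rescaled arithmetic random wave $\Psi_m$ on the segment $\{t(\cos u,\sin u):0\le t\le L\}$. (1) For fixed $m$, suppose that $\nu_m$ has a point mass at $(\cos u,\sin u)$. Then there is a constant $c>0$, independent of $L$, such that $$\mathbb{P}(\mathcal{Z}=0)\ge c>0 .$$ (2) Moreover, let $(m_k)_k$ be a sequence such that $\nu_{m_k}$ has a point mass at $(\cos u,\sin u)$ for all sufficiently large $k$, and $r_2(m_k)\to\infty$. Then for every $\epsilon>0$ there are constants $C_1$ and $C_2$, independent of $L$, such that for all sufficiently large $r_2(m)$, with $m=m_k$, $$-\log\mathbb{P}(\mathcal{Z}=0)<C_1\,r_2(m)<C_2\,m^{\epsilon}.$$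
   Context: For $m$ a sum of two integer squares put $\Lambda_m=\{\lambda\in\mathbb{Z}^2:|\lambda|^2=m\}$ and $r_2(m)=|\Lambda_m|$. The spectral measure is $\nu_m=\frac1{r_2(m)}\sum_{\lambda\in\Lambda_m}\delta_{\lambda/\sqrt m}$ on the unit circle. The rescaled arithmetic random wave is $\Psi_m(x)=\frac{1}{\sqrt{r_2(m)}}\sum_{\lambda\in\Lambda_m}a_\lambda e^{2\pi i\langle\lambda/\sqrt m,x\rangle}$ for $x\in\mathbb{R}^2$, where the $a_\lambda$ are complex standard Gaussians ($\mathbb{E}[a_\lambda]=0$, $\mathbb{E}[|a_\lambda|^2]=1$; real and imaginary parts independent $\mathcal N(0,1/2)$), independent except for $a_{-\lambda}=\overline{a_\lambda}$. $\mathcal{Z}$ is thus the number of zeroes in $[0,L]$ of the process $t\mapsto\Psi_m(t\cos u,t\sin u)$. *)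

(* Defs.v *)
From HB Require Import structures.
From mathcomp Require Import all_boot all_order all_algebra finmap.
From mathcomp Require Import all_classical all_reals all_analysis.
From mathcomp Require Import complex.

Set Implicit Arguments.
Unset Strict Implicit.
Unset Printing Implicit Defensive.

Import Order.TTheory GRing.Theory Num.Theory.
Import numFieldNormedType.Exports.

Local Open Scope classical_set_scope.
Local Open Scope ring_scope.

(* [m = 0] is excluded: [lambda / sqrt m] is meaningless there. *)
Definition sum_of_two_squares (m : nat) : Prop :=
  (0 < m)%N /\ exists x y : int, x ^+ 2 + y ^+ 2 = m%:Z.

Definition Lambda (m : nat) : set (int * int) :=
  [set l | l.1 ^+ 2 + l.2 ^+ 2 = m%:Z].

(* Guards against [fset_set] and [\sum_(_ \in _)] defaulting on infinite sets *)
Lemma finite_Lambda (m : nat) : finite_set (Lambda m).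
Proof.
pose f (p : 'I_(m.*2.+1) * 'I_(m.*2.+1)) : int * int :=
  ((p.1 : nat)%:Z - m%:Z, (p.2 : nat)%:Z - m%:Z).
apply: (@sub_finite_set _ _ (f @` setT)); last first.
  by apply: finite_image; exact: finite_finset.
move=> [x y]; rewrite /Lambda /= => xy.
have bnd (z t : int) : z ^+ 2 + t ^+ 2 = m%:Z ->
    exists i : 'I_(m.*2.+1), (i : nat)%:Z - m%:Z = z.
  move=> zt.
  have zm : `|z| <= m%:Z.
    apply: (@le_trans _ _ (z ^+ 2)); last by rewrite -zt lerDl sqr_ge0.
    have [->|z0] := eqVneq z 0; first by rewrite expr0n normr0.
    by rewrite -real_normK ?num_real// expr2 ler_peMr// -gtz0_ge1 normr_gt0.
  move: zm; rewrite ler_norml => /andP[z1 z2].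
  have z0 : 0 <= z + m%:Z by rewrite -lerBlDr sub0r.
  have zE : (absz (z + m%:Z)%R)%:Z = z + m%:Z by rewrite gez0_abs.
  have zlt : (absz (z + m%:Z)%R < m.*2.+1)%N.
    by rewrite ltnS -lez_nat zE -addnn PoszD lerD2r.
  by exists (Ordinal zlt); rewrite /= zE addrK.
have [i ix] := bnd _ _ xy.
have [j jy] := bnd y x (etrans (addrC _ _) xy).
by exists (i, j) => //; rewrite /f /= ix jy.
Qed.

Definition r2 (m : nat) : nat := #|` fset_set (Lambda m)|.

Section plane.
Context {R : realType}.

Definition scaled (m : nat) (l : int * int) : R * R :=
  (l.1%:~R / Num.sqrt m%:R, l.2%:~R / Num.sqrt m%:R).

Definition dotp (x y : R * R) : R := x.1 * y.1 + x.2 * y.2.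

Definition dir (u : R) : R * R := (cos u, sin u).

Definition expi (theta : R) : R[i] := Complex (cos theta) (sin theta).

End plane.

Section spectral_measure.
Context {R : realType}.
Local Open Scope ereal_scope.

Definition spectral_measure (m : nat) (A : set (R * R)) : \bar R :=
  ((r2 m)%:R^-1)%:E * \sum_(l \in Lambda m) (\d_(scaled m l) A : \bar R).

Variable m : nat.

Let spectral_measureE : spectral_measure m =
  mscale (((r2 m)%:R^-1)%:nng)%R
    (msum (fun k => dirac (scaled m (nth (0%R, 0%R) (fset_set (Lambda m)) k)))
          (r2 m)).
Proof.
apply/funext => A; rewrite /spectral_measure /mscale /msum /=.
rewrite fsbig_finite/=; last exact: finite_Lambda.
by rewrite (big_nth (0%R, 0%R)) big_mkord.
Qed.

Let spectral_measure0 : spectral_measure m set0 = 0.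
Proof. by rewrite spectral_measureE measure0. Qed.

Let spectral_measure_ge0 A : 0 <= spectral_measure m A.
Proof. by rewrite spectral_measureE. Qed.

Let spectral_measure_sigma_additive :
  semi_sigma_additive (spectral_measure m).
Proof. by rewrite spectral_measureE; exact: measure_semi_sigma_additive. Qed.

HB.instance Definition _ := isMeasure.Build _ _ _ (spectral_measure m)
  spectral_measure0 spectral_measure_ge0 spectral_measure_sigma_additive.

Definition has_point_mass (nu : set (R * R) -> \bar R) (p : R * R) : Prop :=
  0 < nu [set p].

End spectral_measure.

Section random_wave.
Context {R : realType} {d : measure_display} {T : measurableType d}.
Variable P : probability T R.

(* Mutual independence of the real random variables [X i], [i] in [D] *)
Definition mutually_independent (I : choiceType) (D : set I)
    (X : I -> {RV P >-> R}) : Prop :=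
  forall (J : {fset I}) (B : I -> set R),
    [set` J] `<=` D -> (forall i, measurable (B i)) ->
    P (\bigcap_(i in [set` J]) (X i @^-1` B i)) =
    (\prod_(i <- J) P (X i @^-1` B i))%E.

(* [normal_prob] takes the standard deviation, not the variance. *)
Definition gaussian (var : R) (X : {RV P >-> R}) : Prop :=
  forall B : set R, measurable B ->
    distribution P X B = normal_prob 0 (Num.sqrt var) B.

(* [X l] and [Y l] are the real and imaginary parts of [a_l]. "Independent
   except for a_(-l) = conj(a_l)": independent over every set of frequencies
   that does not contain two opposite ones. *)
Record wave_coefficients (m : nat) (X Y : int * int -> {RV P >-> R}) : Prop := {
  coef_conj : forall l, Lambda m l -> forall w,
    Complex (X (- l) w) (Y (- l) w) = (Complex (X l w) (Y l w))^*%C ;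
  coef_re : forall l, Lambda m l -> gaussian (1 / 2) (X l) ;
  coef_im : forall l, Lambda m l -> gaussian (1 / 2) (Y l) ;
  coef_indep : forall H : set (int * int), H `<=` Lambda m ->
    (forall l, H l -> ~ H (- l)) ->
    mutually_independent (H `*` [set: bool])
      (fun i => if i.2 then Y i.1 else X i.1) }.

Definition Psi (m : nat) (X Y : int * int -> {RV P >-> R})
    (x : R * R) (w : T) : R[i] :=
  Complex (Num.sqrt (r2 m)%:R)^-1 0 *
  \sum_(l \in Lambda m)
    Complex (X l w) (Y l w) * expi (2 * pi * dotp (scaled m l) x).

(* Number of zeroes on the segment, [+oo] if there are infinitely many *)
Definition nb_zeroes (u : R) (m : nat) (L : R)
    (X Y : int * int -> {RV P >-> R}) (w : T) : \bar R :=
  counting [set t : R | t \in `[0, L] /\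
                        Psi m X Y (t * (dir u).1, t * (dir u).2) w = 0].

Definition prob_no_zero (u : R) (m : nat) (L : R)
    (X Y : int * int -> {RV P >-> R}) : \bar R :=
  P [set w | nb_zeroes u m L X Y w = 0%E].

End random_wave.

Arguments wave_coefficients {R d T} P m X Y.
Arguments prob_no_zero {R d T} P u m L X Y.

(* Main.v *)
Require Import Defs.
From mathcomp Require Import all_boot all_order all_algebra finmap.
From mathcomp Require Import zify ring lra.
From mathcomp Require Import all_classical all_reals all_analysis.
From mathcomp Require Import measurable_realfun complex.

Set Implicit Arguments.
Unset Strict Implicit.
Unset Printing Implicit Defensive.
Import Order.TTheory GRing.Theory Num.Theory.
Import numFieldNormedType.Exports.

Local Open Scope classical_set_scope.
Local Open Scope ring_scope.

(** A point mass at (cos u, sin u) means that some element of Lambda_m points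
    along the segment.  Its quarter turn is again in Lambda_m and is orthogonal to
    the segment, so the exponential attached to it is constant there.  Hence along
    the segment the wave is, up to a positive factor,
    V_0 + f(t) with f(t) = \sum_i V_i phi_i(t), where V_0 and the V_i are at
    most n = r2(m) independent N(0, 1/2) variables and the phi_i are cosines and
    sines of frequency at most 2 pi ([wave_decomposition]).  There is no zero
    on [0, L] as soon as V_0 exceeds the supremum of |f| on [0, L].

    For fixed m, let N be the number of the V_i.  Then V_0 >= 1 together with
    0 <= V_i < 1/(N + 1) for all i forces this for every L at once, and these
    conditions describe a rectangle of positive probability
    ([prob_no_zero_uniform]).

    For n large, V_0 >= C sqrt n costs only exp(-O(n)), and it remains to make
    |f| at most O(sqrt n) on [0, L] with probability exp(-O(n)), the implied
    constant being independent of L.  Bounding every |V_i| by 1/sqrt n would cost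
    a factor log n in the exponent.  Instead the V_i are kept of order 1 and
    cancellation comes from a pigeonhole argument ([many_small_combinations]):
    with K = n, among the K^N coefficient vectors with entries in
    {0, 1/K, ..., (K-1)/K}, sort the sums by their values, rounded to integers, at
    about L sqrt n equally spaced points.  There are only exp(O(L sqrt n log n)) possible outcomes, which
    is below 2^n once n is large in terms of L, so at least K^N / 2^n vectors give
    the same outcome.  The differences of these vectors with one of them are that
    many vectors with entries in [-1, 1] whose sum is O(1) at the sample points,
    hence O(sqrt n) everywhere since f is O(n)-Lipschitz.  The cubes of side 1/K at
    these differences are disjoint and each has probability at least (c/K)^N
    ([prob_boxes]), so altogether the probability is at least c^N / 2^n.

    Finally r2(m) = O(m^eps) because r2(m) is at most a constant times the square
    of the number of divisors of m ([r2_le_divisors]), and that number is O(m^eps)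
    ([divisor_bound]).

    The event without zeroes is an uncountable intersection; its measurability,
    required to compare its probability with that of the rectangles, is
    [measurable_no_zero]. *)

(** * The number of divisors *)

(** The list of divisors is built from the prime factorisation by multiplying the
    list obtained so far by the powers of the next prime, with exponents from 0 up
    to its multiplicity. *)
Lemma size_divisors (n : nat) :
  size (divisors n) = (\prod_(f <- prime_decomp n) f.2.+1)%N.
Proof.
rewrite /divisors; elim: (prime_decomp n) => [|[p e] pd IH]; first by rewrite big_nil.
rewrite big_cons /= -IH; set divs := foldr _ _ _.
elim: e => [|e IHe] /=; first by rewrite mul1n.
by rewrite size_merge size_cat size_map IHe mulSn addnC.
Qed.

Section divisor_bound.
Context {R : realType}.

(** One Euler factor of the divisor bound: beyond [Q] the power p^(e eps) is at
    least 2^e and beats e + 1 unaided, and each of the primes below [Q] loses at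
    most the factor [B], because exp(x) >= 1 + x. *)
Lemma prime_power_factor_bound (eps B : R) (Q p e : nat) :
  1 <= B -> 1 <= B * (eps * ln 2) -> 2 <= Q%:R `^ eps -> 0 < eps -> (1 < p)%N ->
  e.+1%:R <= B ^+ (p < Q)%N * (p ^ e)%:R `^ eps.
Proof.
move=> B1 Bln hQ e0 p1.
have p0 : (0 : R) <= p%:R by [].
have -> : ((p ^ e)%:R : R) `^ eps = (p%:R `^ eps) ^+ e.
  by rewrite natrX -powR_mulrn// -powRrM mulrC powRrM powR_mulrn ?powR_ge0.
case: (ltnP p Q) => [_|Qp]; last first.
  rewrite expr0 mul1r; apply: (@le_trans _ _ (2 ^+ e)).
    by rewrite -natrX ler_nat ltn_expl.
  apply: lerXn2r; rewrite ?nnegrE ?powR_ge0//.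
  by apply: (le_trans hQ); apply: ge0_ler_powR; rewrite ?nnegrE ?ler_nat// ltW.
have -> : B ^+ true = B by [].
apply: (@le_trans _ _ (B * (2 `^ eps) ^+ e)); last first.
  rewrite ler_wpM2l ?(le_trans ler01)//; apply: lerXn2r; rewrite ?nnegrE ?powR_ge0//.
  by apply: ge0_ler_powR; rewrite ?nnegrE ?ler_nat// ltW.
have -> : (2 `^ eps) ^+ e = expR (e%:R * (eps * ln 2)) :> R.
  by rewrite /powR pnatr_eq0/= -expRM_natl.
apply: (@le_trans _ _ (B * (1 + e%:R * (eps * ln 2)))); last first.
  by rewrite ler_wpM2l ?(le_trans ler01)// expR_ge1Dx.
rewrite mulrDr mulr1 mulrCA -natr1 addrC lerD//.
by rewrite ler_peMr.
Qed.

(** The Euler factors that cost more than 1 belong to primes below a bound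
    depending on eps only, so the loss is at most a fixed power of [B]. *)
Lemma divisor_bound (eps : R) : 0 < eps -> exists2 C : R, 1 <= C &
  forall m, (0 < m)%N -> (size (divisors m))%:R <= C * m%:R `^ eps.
Proof.
move=> e0.
have ln20 : 0 < ln 2 :> R by rewrite ln_gt0// ltr1n.
have eln0 : 0 < eps * ln 2 by rewrite mulr_gt0.
pose B : R := Num.max 1 (eps * ln 2)^-1.
have B1 : 1 <= B by rewrite /B le_max lexx.
have Bln : 1 <= B * (eps * ln 2).
  by rewrite -ler_pdivrMr// div1r /B le_max lexx orbT.
pose Q := (Num.truncn ((2 : R) `^ eps^-1)).+1.
have hQ : 2 <= Q%:R `^ eps.
  apply: (@le_trans _ _ ((2 `^ eps^-1) `^ eps)).
    by rewrite -powRrM mulVf ?gt_eqF// powRr1.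
  apply: ge0_ler_powR; rewrite ?nnegrE ?powR_ge0// ?ltW// /Q.
  by rewrite truncnS_gt.
exists (B ^+ Q) => [|m m0]; first exact: exprn_ege1.
have key (pd : seq (nat * nat)) : all (fun f => 1 < f.1)%N pd ->
    (\prod_(f <- pd) f.2.+1)%:R <=
    B ^+ (count (fun p => p < Q)%N (unzip1 pd)) *
    (\prod_(f <- pd) f.1 ^ f.2)%:R `^ eps.
  elim: pd => [|[p e] pd IH] /=; first by rewrite !big_nil expr0 mul1r powR1.
  move=> /andP[p1 /IH{}IH]; rewrite !big_cons/= !natrM powRM//.
  rewrite exprD mulrACA; apply: ler_pM => //.
  exact: prime_power_factor_bound.
rewrite size_divisors [in X in _ * X `^ _](prod_prime_decomp m0).
apply: (le_trans (key _ _)).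
  by apply/allP => -[p e] /mem_prime_decomp[/prime_gt1].
rewrite ler_wpM2r ?powR_ge0//; apply: ler_weXn2l => //.
rewrite -size_filter -[leqRHS](size_iota 0); apply: uniq_leq_size.
  by rewrite filter_uniq// primes_uniq.
by move=> p; rewrite mem_filter mem_iota => /andP[].
Qed.

End divisor_bound.

(** * Representations as a sum of two squares *)

Lemma size_le_fibres (T U : eqType) (f : T -> U) (c : nat) (r : seq U) (s : seq T) :
  {in s, forall x, f x \in r} ->
  (forall u, u \in r -> size [seq x <- s | f x == u] <= c)%N ->
  (size s <= c * size r)%N.
Proof.
elim: r s => [|u r IH] s fr cr.
  by case: s fr {cr} => // x s /(_ x (mem_head _ _)).
rewrite -(count_predC (fun x => f x == u)) mulnS leq_add//.
  by rewrite -size_filter cr ?mem_head.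
rewrite -size_filter; apply: IH => [x|v vr].
  rewrite mem_filter => /andP[/= fxu xs].
  by have := fr _ xs; rewrite inE (negbTE fxu).
rewrite -filter_predI; apply: leq_trans (cr v _); last by rewrite inE vr orbT.
rewrite !size_filter; apply: sub_count => x /= /andP[]//.
Qed.

(** In terms of Gaussian integers, with z fixed, the product of z' with the
    conjugate of z has imaginary part D and real part E, and D^2 + E^2 = m^2.
    If m divides 2 D then 2 D / m lies in {-2, ..., 2}; this number and the sign of
    E, ten possibilities in all, determine D and E, hence z'. *)
Lemma small_fibre (m : nat) (s : seq (int * int)) : (0 < m)%N -> uniq s ->
  {in s, forall z, Lambda m z} ->
  {in s &, forall z z', (m %| 2 * (z.1 * z'.2 - z'.1 * z.2))%Z} ->
  (size s <= 10)%N.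
Proof.
move=> m0; case: s => // -[x y] l; set s := _ :: l => us reps dv.
have zs : (x, y) \in s by rewrite mem_head.
have m0z : (m%:Z != 0 :> int) by lia.
have hz : x ^+ 2 + y ^+ 2 = m%:Z := reps _ zs.
pose D (z : int * int) := x * z.2 - z.1 * y.
pose E (z : int * int) := x * z.1 + y * z.2.
have DE z : z \in s -> D z ^+ 2 + E z ^+ 2 = m%:Z ^+ 2.
  move=> /reps hz'.
  have -> : m%:Z ^+ 2 = (x ^+ 2 + y ^+ 2) * (z.1 ^+ 2 + z.2 ^+ 2).
    by rewrite hz [X in _ * X]hz' expr2.
  by rewrite /D /E; ring.
pose key z := (((2 * D z) %/ m)%Z, 0 <= E z).
have Dkey z : z \in s -> 2 * D z = (key z).1 * m%:Z.
  by move=> zs'; rewrite /= divzK//; exact: (dv _ _ zs zs').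
pose keys := [seq (i, b) | i <- [:: -2; -1; 0; 1; 2 : int], b <- [:: true; false]].
rewrite -(size_map key) (_ : 10%N = size keys)//; apply: uniq_leq_size.
  rewrite map_inj_in_uniq// => z z' zs1 zs2 kk.
  have DD : D z = D z'.
    have := Dkey _ zs1; rewrite kk -(Dkey _ zs2) => /(mulfI _); exact.
  have EE2 : E z ^+ 2 = E z' ^+ 2.
    by apply: (addrI (D z ^+ 2)); rewrite DE// DD DE.
  have EE : E z = E z'.
    move/eqP: EE2; rewrite eqf_sqr => /orP[/eqP//|/eqP Eo].
    have := congr1 snd kk; rewrite /= Eo; lia.
  have inv1 w : m%:Z * w.1 = x * E w - y * D w by rewrite -hz /E /D; ring.
  have inv2 w : m%:Z * w.2 = y * E w + x * D w by rewrite -hz /E /D; ring.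
  have := inv1 z; rewrite EE DD -inv1 => /(mulfI m0z) e1.
  have := inv2 z; rewrite EE DD -inv2 => /(mulfI m0z) e2.
  by case: z z' e1 e2 {zs1 zs2 kk DD EE EE2} => ? ? [? ?] /= -> ->.
move=> _ /mapP[z zs' ->]; have := Dkey _ zs'; have := DE _ zs'.
rewrite /key /=; set k := (_ %/ _)%Z; set d := D z; set e := E z => h1 h2.
have : k \in [:: -2; -1; 0; 1; 2 : int].
  have : k ^+ 2 <= 4.
    have : k ^+ 2 * m%:Z ^+ 2 <= 4 * m%:Z ^+ 2.
      rewrite -exprMn -h2 -h1 exprMn mulrDr (_ : 2 ^+ 2 = 4 :> int)//.
      by rewrite lerDl mulr_ge0// sqr_ge0.
    rewrite ler_pM2r// exprn_gt0//; lia.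
  rewrite -[4]/(2 ^+ 2 : int) -[k ^+ 2]real_normK ?num_real// ler_sqr//.
  by rewrite ler_norml !inE; lia.
move=> kin; apply/allpairsP; exists (k, 0 <= e); split=> //=.
by case: (0 <= e).
Qed.

(** Fix a primitive representation (x0, y0) and put a = x y0 - x0 y and
    b = x y0 + x0 y.  Since a b = m (x^2 - x0^2), m divides a b, and g = gcd(m, a)
    splits m into g, dividing a, and m/g, dividing b.  For two primitive
    representations with the same g, both g and m/g divide the determinant D of
    the pair.  Their gcd divides 2 x y0, where x and y0 are coprime to m, so it
    divides 2; thus m divides 2 D and [small_fibre] applies to each value of g. *)
Lemma primitive_representations (m : nat) (s : seq (int * int)) : (0 < m)%N ->
  uniq s -> {in s, forall z, Lambda m z /\ coprimez z.1 z.2} ->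
  (size s <= 10 * size (divisors m))%N.
Proof.
move=> m0; case: s => // -[x0 y0] l; set s := _ :: l => us reps.
have [hz0 cp0] : _ /\ coprimez x0 y0 := reps _ (mem_head _ _).
have cop1 x y : Lambda m (x, y) -> coprimez x y -> coprimez m%:Z y.
  rewrite /Lambda/= => <- cxy.
  rewrite coprimez_sym /coprimez addrC expr2 gcdzMDl -/(coprimez _ _).
  by rewrite coprimezXr// coprimez_sym.
have copy0 : coprimez m%:Z y0 := cop1 _ _ hz0 cp0.
pose a (z : int * int) := z.1 * y0 - x0 * z.2.
pose b (z : int * int) := z.1 * y0 + x0 * z.2.
pose f z := gcdn m `|a z|%N.
apply: (@size_le_fibres _ _ f) => [z zs|g].
  by rewrite -dvdn_divisors// dvdn_gcdl.
rewrite -dvdn_divisors// => /dvdnP[m' mE].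
apply: (@small_fibre m) => //; first by rewrite filter_uniq.
  by move=> z; rewrite mem_filter => /andP[_ /reps[]].
have g0 : (0 < g)%N by lia.
have ga z : f z = g -> (g %| a z)%Z.
  by move=> <-; rewrite dvdzE dvdn_gcdr.
have m'b z : z \in s -> f z = g -> (m' %| b z)%Z.
  move=> zs fz; have [hz cz] := reps _ zs.
  have : (m %| a z * b z)%Z.
    have -> : a z * b z = m%:Z * (z.1 ^+ 2 - x0 ^+ 2).
      rewrite /a /b (_ : _ * _ = z.1 ^+ 2 * y0 ^+ 2 - x0 ^+ 2 * z.2 ^+ 2); last by ring.
      have -> : y0 ^+ 2 = m%:Z - x0 ^+ 2 by rewrite -hz0/=; ring.
      have -> : z.2 ^+ 2 = m%:Z - z.1 ^+ 2 by rewrite -hz/=; ring.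
      ring.
    exact: dvdz_mulr.
  rewrite !dvdzE abszM /= => h.
  have cgm : coprime m' (`|a z| %/ g).
    rewrite /coprime -(eqn_pmul2r g0) mul1n muln_gcdl -mE divnK; last first.
      exact: (ga _ fz).
    by apply/eqP.
  rewrite -(Gauss_dvdr _ cgm) -(@dvdn_pmul2r g)// -mE.
  by rewrite mulnAC divnK//; exact: (ga _ fz).
move=> z z'; rewrite !mem_filter => /andP[/eqP fz zs] /andP[/eqP fz' zs'].
pose D := z.1 * z'.2 - z'.1 * z.2.
have copg : coprimez g%:Z y0.
  by apply: coprimez_dvdl copy0; rewrite [X in (_ %| X)%N]mE dvdn_mull.
have copm' : coprimez m'%:Z y0.
  by apply: coprimez_dvdl copy0; rewrite [X in (_ %| X)%N]mE dvdn_mulr.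
have gD : (g %| D)%Z.
  rewrite -(Gauss_dvdzr _ copg).
  have -> : y0 * D = a z * z'.2 - a z' * z.2 by rewrite /a /D; ring.
  by apply: rpredB; apply: dvdz_mulr; exact: ga.
have m'D : (m' %| D)%Z.
  rewrite -(Gauss_dvdzr _ copm').
  have -> : y0 * D = b z * z'.2 - b z' * z.2 by rewrite /b /D; ring.
  by apply: rpredB; apply: dvdz_mulr; exact: m'b.
pose h := gcdn m' g.
have h2 : (h %| 2)%Z.
  have hm : (h %| m)%N by rewrite [X in (_ %| X)%N]mE dvdn_mulr// dvdn_gcdl.
  have ch y : coprimez m%:Z y -> coprimez h y by apply: coprimez_dvdl.
  have [hz cz] := reps _ zs.
  have c1 : coprimez h z.1.
    apply: ch; apply: (cop1 z.2) => /=; last by rewrite coprimez_sym.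
    by rewrite /Lambda /= addrC.
  rewrite -(Gauss_dvdzr _ c1) -(Gauss_dvdzr _ (ch _ copy0)).
  have -> : y0 * (z.1 * 2) = a z + b z by rewrite /a /b; ring.
  apply: rpredD.
    by apply: dvdz_trans (ga _ fz); rewrite dvdzE /= dvdn_gcdr.
  by apply: dvdz_trans (m'b _ zs fz); rewrite dvdzE /= dvdn_gcdl.
rewrite dvdzE abszM /= mE -muln_lcm_gcd mulnC dvdn_mul//.
by rewrite dvdn_lcm; apply/andP.
Qed.

(** Sort the representations by the gcd h of the two coordinates, a divisor of m;
    dividing by h gives primitive representations of m / h^2. *)
Lemma r2_le_divisors (m : nat) : (0 < m)%N ->
  (r2 m <= 10 * size (divisors m) * size (divisors m))%N.
Proof.
move=> m0; rewrite /r2; set s := enum_fset _.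
pose f (z : int * int) := gcdn `|z.1| `|z.2|.
have sL z : z \in s -> Lambda m z.
  by rewrite in_fset_set ?inE//; exact: finite_Lambda.
have fsq z : z \in s -> (f z ^ 2 %| m)%N.
  move=> /sL hz.
  have : ((f z ^ 2)%N%:Z %| m%:Z)%Z.
    rewrite -hz; apply: rpredD; rewrite dvdzE /= abszX dvdn_exp2r//.
      exact: dvdn_gcdl.
    exact: dvdn_gcdr.
  by rewrite dvdzE.
apply: (@size_le_fibres _ _ f) => [z /fsq fz|h hm].
  by rewrite -dvdn_divisors//; apply: dvdn_trans fz; rewrite dvdn_exp.
set t := [seq _ <- _ | _].
have [->//|tn] := eqVneq t [::].
have th z : z \in t -> f z = h by rewrite mem_filter => /andP[/eqP].
have ts z : z \in t -> z \in s by rewrite mem_filter => /andP[].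
have hhm : (h ^ 2 %| m)%N.
  case: t tn th ts => // z t _ th ts.
  by rewrite -(th z) ?mem_head// fsq// ts ?mem_head.
have h0 : (0 < h)%N by case: h hhm {hm t tn th ts} => //; lia.
pose m1 := (m %/ h ^ 2)%N.
have mE : m = (m1 * h ^ 2)%N by rewrite divnK.
have m10 : (0 < m1)%N by lia.
pose g (z : int * int) := ((z.1 %/ h)%Z, (z.2 %/ h)%Z).
have gE z : z \in t -> z.1 = (g z).1 * h%:Z /\ z.2 = (g z).2 * h%:Z.
  by move=> /th hz; split; rewrite /= divzK// dvdzE -hz ?dvdn_gcdl ?dvdn_gcdr.
apply: (@leq_trans (10 * size (divisors m1))).
  rewrite -(size_map g); apply: primitive_representations => //.
    rewrite map_inj_in_uniq ?filter_uniq ?fset_uniq// => z z' zt zt' gg.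
    have [e1 e2] := gE _ zt; have [e1' e2'] := gE _ zt'.
    rewrite (surjective_pairing z) (surjective_pairing z').
    by rewrite e1 e2 e1' e2' gg.
  move=> _ /mapP[z zt ->]; have [e1 e2] := gE _ zt; split.
    have hh : z.1 ^+ 2 + z.2 ^+ 2 = m%:Z := sL _ (ts _ zt).
    have hz : h%:Z ^+ 2 != 0 by rewrite expf_neq0//; lia.
    have mz : m%:Z = m1%:Z * h%:Z ^+ 2 by rewrite [in LHS]mE PoszM.
    apply: (mulIf hz); rewrite -mz -hh e1 e2.
    by move: (g z).1 (g z).2 => p q; ring.
  rewrite coprimezE /coprime -(eqn_pmul2r h0) mul1n muln_gcdl.
  have := th _ zt; rewrite /f e1 e2 !abszM /= => ->; exact: eqxx.
rewrite leq_mul2l /=; apply: uniq_leq_size; first exact: divisors_uniq.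
by move=> q; rewrite -!dvdn_divisors// => qm; rewrite mE dvdn_mulr.
Qed.

Lemma r2_bound {R : realType} (eps : R) : 0 < eps -> exists2 C : R, 0 < C &
  forall m, (0 < m)%N -> (r2 m)%:R <= C * m%:R `^ eps.
Proof.
move=> e0; have [|C C1 hC] := @divisor_bound R (eps / 2); first by rewrite divr_gt0.
exists (10 * C ^+ 2) => [|m m0]; first by rewrite mulr_gt0// exprn_gt0// (lt_le_trans ltr01).
apply: (@le_trans _ _ (10 * (size (divisors m))%:R ^+ 2)).
  by rewrite expr2 mulrA -!natrM ler_nat r2_le_divisors.
have -> : m%:R `^ eps = (m%:R `^ (eps / 2)) ^+ 2 :> R.
  by rewrite -powR_mulrn ?powR_ge0// -powRrM divfK.
rewrite -mulrA -exprMn ler_wpM2l//.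
by apply: lerXn2r; rewrite ?nnegrE ?mulr_ge0 ?powR_ge0 ?hC// (le_trans ler01).
Qed.

(** * Independent Gaussians in disjoint boxes *)

Section gaussian_boxes.
Context {R : realType} {d : measure_display} {T : measurableType d}.
Variable P : probability T R.

Definition half_peak : R := normal_peak (Num.sqrt (1 / 2)).

Lemma half_peak_gt0 : 0 < half_peak.
Proof. by rewrite normal_peak_gt0// gt_eqF// sqrtr_gt0 divr_gt0. Qed.

(** The density at x of a centred Gaussian of variance 1/2 is [half_peak] times
    exp(-x^2), so it is at least its value at the farthest admissible distance. *)
Lemma gaussian_itv (X : {RV P >-> R}) (a h r : R) : gaussian (1 / 2) X ->
  0 < h -> (forall x, a <= x < a + h -> `|x| <= r) ->
  ((half_peak * expR (- r ^+ 2) * h)%:E <= P (X @^-1` (`[a, (a + h)%R[%classic : set R)))%E.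
Proof.
move=> gX h0 ler; set B : set R := `[a, a + h[%classic.
have mB : measurable B by exact: measurable_itv.
rewrite -[P _]/(distribution P X B) gX//.
have s0 : Num.sqrt (1 / 2) != 0 :> R by rewrite gt_eqF// sqrtr_gt0 divr_gt0.
have <- : (\int[lebesgue_measure]_(x in B)
    cst (half_peak * expR (- r ^+ 2))%:E x)%E =
    (half_peak * expR (- r ^+ 2) * h)%:E.
  rewrite integral_cst// [RHS]EFinM; congr (_ * _)%E.
  rewrite /= /B; have := @lebesgue_measure_itv R `[a, a + h[.
  by rewrite /= lte_fin ltrDl h0 -EFinB addrAC subrr add0r.
apply: ge0_le_integral => //.
- by move=> x _; rewrite lee_fin mulr_ge0 ?expR_ge0// ltW// half_peak_gt0.
- by apply/measurable_EFinP; apply: measurable_funTS; exact: measurable_normal_pdf.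
move=> x; rewrite /B/= in_itv/= => /ler xr.
rewrite lee_fin normal_pdfE// /normal_fun subr0 sqr_sqrtr ?divr_ge0//.
apply: ler_wpM2l; first exact/ltW/half_peak_gt0.
rewrite ler_expR.
rewrite (_ : 1 / 2 *+ 2 = 1); last by rewrite -mulr_natr divfK.
rewrite divr1 lerN2 -[x ^+ 2]real_normK ?num_real//.
by apply: lerXn2r; rewrite ?nnegrE// (le_trans _ xr).
Qed.

Section boxes.
Context {I : choiceType}.
Variables (V : I -> {RV P >-> R}) (J : {fset I}) (i0 : I).
Hypotheses (indV : mutually_independent [set` (i0 |` J)%fset] V) (i0J : i0 \notin J).
Hypotheses (gV : forall i, i \in (i0 |` J)%fset -> gaussian (1 / 2) (V i)).

Lemma prob_rectangle (B : I -> set R) (a b : R) : 0 <= a -> 0 <= b ->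
  (forall i, measurable (B i)) ->
  (a%:E <= P (V i0 @^-1` B i0))%E ->
  (forall i, i \in J -> (b%:E <= P (V i @^-1` B i))%E) ->
  ((a * b ^+ #|` J|)%:E <=
    P (\bigcap_(i in [set` (i0 |` J)%fset]) (V i @^-1` B i)))%E.
Proof.
move=> a0 b0 mB aP bP; rewrite indV// big_fsetU1//= EFinM.
apply: lee_pmul; rewrite ?lee_fin ?exprn_ge0//.
have key (s : seq I) :
    {in s, forall i, (b%:E <= P (V i @^-1` B i))%E} ->
    ((b ^+ size s)%:E <= \prod_(i <- s) P (V i @^-1` B i))%E.
  elim: s => [|i s IH] h; first by rewrite big_nil.
  rewrite big_cons /= exprS EFinM; apply: lee_pmul; rewrite ?lee_fin ?exprn_ge0//.
    by apply: h; rewrite mem_head.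
  by apply: IH => j js; apply: h; rewrite inE js orbT.
exact: key.
Qed.

Definition offset (K : nat) (k k0 : {ffun J -> 'I_K}) (j : J) : R :=
  ((k j)%:R - (k0 j)%:R) / K%:R.

(** The cube of side 1/K whose corner is the difference of [k] and [k0], times the
    interval [a, a+1) in the distinguished coordinate [i0]. *)
Definition box (a : R) (K : nat) (k k0 : {ffun J -> 'I_K}) (i : I) : set R :=
  if i == i0 then `[a, a + 1[%classic
  else if insub i is Some j then
    `[offset k k0 j, offset k k0 j + K%:R^-1[%classic
  else setT.

Lemma offset_bound (K : nat) (k k0 : {ffun J -> 'I_K}) (j : J) (x : R) :
  offset k k0 j <= x < offset k k0 j + K%:R^-1 -> `|x| <= 1.
Proof.
move=> /andP[h1 h2].
have K0 : 0 < K%:R :> R by rewrite ltr0n; case: (K) (k j) => // -[].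
have b (l : {ffun J -> 'I_K}) : (l j)%:R + 1 <= K%:R :> R.
  by rewrite natr1 ler_nat.
have := b k; have := b k0 => b1 b2.
have p1 : 0 <= (k j)%:R :> R by [].
have p2 : 0 <= (k0 j)%:R :> R by [].
rewrite ler_norml; apply/andP; split.
  apply: le_trans h1; rewrite /offset ler_pdivlMr// mulN1r; lra.
apply: (le_trans (ltW h2)).
rewrite /offset -[X in _ + X]div1r -mulrDl ler_pdivrMr// mul1r; lra.
Qed.

(** The cubes attached to distinct [k] are disjoint, being half-open and based at
    points of a grid of step 1/K, so their probabilities add up. *)
Lemma prob_boxes (K : nat) (S : {set {ffun J -> 'I_K}}) (k0 : {ffun J -> 'I_K})
    (a : R) : (0 < K)%N -> 0 <= a ->
  exists E : set T, [/\ measurable E,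
    forall w, E w -> exists2 k, k \in S & a <= V i0 w /\
      forall j : J, offset k k0 j <= V (val j) w < offset k k0 j + K%:R^-1 &
    ((#|S|%:R * (half_peak * expR (- (a + 1) ^+ 2) *
        (half_peak * expR (- 1) / K%:R) ^+ #|` J|))%:E <= P E)%E].
Proof.
move=> K0 a0.
pose ev k := \bigcap_(i in [set` (i0 |` J)%fset]) (V i @^-1` box a k k0 i).
have mbox k i : measurable (box a k k0 i).
  by rewrite /box; case: eqP => // _; case: insubP.
have mev k : measurable (ev k).
  apply: fin_bigcap_measurable; first exact: finite_fset.
  by move=> i _; rewrite -[X in measurable X]setTI; exact: measurable_funP.
have Kr : 0 < K%:R^-1 :> R by rewrite invr_gt0 ltr0n.
have evP k w : ev k w -> a <= V i0 w /\
    forall j : J, offset k k0 j <= V (val j) w < offset k k0 j + K%:R^-1.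
  move=> ew; split.
    have := ew i0; rewrite /= fset1U1 /box eqxx/= in_itv/= => /(_ isT) /andP[]//.
  move=> j; have := ew (val j); rewrite /= !inE fsvalP orbT => /(_ isT).
  rewrite /box; case: eqP => [ji0|_].
    by have := i0J; rewrite -ji0 fsvalP.
  by rewrite valK /= in_itv.
exists (\bigcup_(k in [set` S]) ev k); split.
- by apply: fin_bigcup_measurable => // ; exact: finite_finset.
- by move=> w [k kS /evP]; exists k.
rewrite measure_fin_bigcup; [|exact: finite_finset| |by move=> k _; exact: mev]; last first.
  move=> k k' _ _ [w [/evP[_ wk] /evP[_ wk']]]; apply/ffunP => j.
  have /andP[l1 u1] := wk j; have /andP[l2 u2] := wk' j.
  have KK : K%:R != 0 :> R by rewrite pnatr_eq0 -lt0n.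
  have step (p q : {ffun J -> 'I_K}) : offset p k0 j < offset q k0 j + K%:R^-1 ->
      (p j <= q j)%N.
    have -> : offset q k0 j + K%:R^-1 = ((q j)%:R - (k0 j)%:R + 1) / K%:R :> R.
      by rewrite mulrDl mul1r.
    rewrite /offset ltr_pM2r//.
    rewrite addrAC ltrD2r natr1 ltr_nat ltnS//.
  apply/val_inj/eqP; rewrite eqn_leq; apply/andP; split; apply: step.
    exact: le_lt_trans l1 u2.
  exact: le_lt_trans l2 u1.
rewrite fsbig_finite/=; last exact: finite_finset.
have le1 k : ((half_peak * expR (- (a + 1) ^+ 2) *
        (half_peak * expR (- 1) / K%:R) ^+ #|` J|)%:E <= P (ev k))%E.
  apply: prob_rectangle => //.
  - by rewrite mulr_ge0 ?expR_ge0// ltW// half_peak_gt0.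
  - by rewrite divr_ge0// mulr_ge0 ?expR_ge0// ltW// half_peak_gt0.
  - rewrite /box eqxx -[X in (X%:E <= _)%E]mulr1; apply: gaussian_itv => //.
      by apply: gV; rewrite fset1U1.
    by move=> x /andP[ax /ltW xa]; rewrite ger0_norm// (le_trans a0 ax).
  move=> i iJ; have -> : box a k k0 i =
      `[offset k k0 [` iJ]%fset, offset k k0 [` iJ]%fset + K%:R^-1[%classic.
    rewrite /box; case: eqP => [ii0|_]; first by have := i0J; rewrite -ii0 iJ.
    by have -> : insub i = Some [` iJ]%fset by exact: (valK [` iJ]%fset).
  rewrite -[X in expR (- X)](expr1n _ 2); apply: gaussian_itv => //.
    by apply: gV; rewrite !inE iJ orbT.
  by move=> x; exact: offset_bound.
apply: (@le_trans _ _ (\sum_(k <- fset_set [set` S])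
   ((half_peak * expR (- (a + 1) ^+ 2) *
        (half_peak * expR (- 1) / K%:R) ^+ #|` J|)%:E))%E); last first.
  by apply: lee_sum => k _; exact: le1.
rewrite sumEFin big_const_seq count_predT iter_addr_0 lee_fin -[leRHS]mulr_natl.
have -> : size (fset_set [set` S]) = #|S|.
  rewrite cardE; apply/perm_size/uniq_perm; rewrite ?fset_uniq ?enum_uniq// => k.
  by rewrite in_fset_set ?mem_enum; [rewrite mem_setE | exact: finite_finset].
by [].
Qed.

End boxes.
End gaussian_boxes.

(** * Small linear combinations by pigeonhole *)

Lemma pigeonhole_fibre (X U : finType) (f : X -> U) (x0 : X) :
  exists u, (#|X| <= #|[set x | f x == u]%SET| * #|U|)%N.
Proof.
pose c u := #|[set x | f x == u]%SET|.
have [u _ umax] := @arg_maxnP U (f x0) xpredT c isT.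
exists u; rewrite -[#|X|]sum1_card (partition_big f xpredT)//=.
apply: (@leq_trans (\sum_(v : U) c u)%N); last by rewrite sum_nat_const mulnC.
apply: leq_sum => v _; rewrite sum1dep_card.
exact: umax.
Qed.

Lemma natr_trunc_bounds {R : realType} (x : R) : 0 <= x ->
  (Num.truncn x)%:R <= x < (Num.truncn x)%:R + 1.
Proof. by move=> x0; rewrite natr1; exact: truncn_itv. Qed.

Section pigeonhole.
Context {R : realType} {I : choiceType}.
Variables (J : {fset I}) (phi : I -> R -> R) (lip L : R) (M K : nat).
Hypotheses (lip0 : 0 <= lip) (L0 : 0 < L) (M0 : (0 < M)%N) (K0 : (0 < K)%N).
Hypothesis phi1 : forall (j : J) t, `|phi (val j) t| <= 1.
Hypothesis phi_lip : forall (j : J) s t,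
  `|phi (val j) s - phi (val j) t| <= lip * `|s - t|.

Let N : nat := #|` J|.
Let node (m : 'I_M.+1) : R := m%:R * (L / M%:R).
Let F (k : {ffun J -> 'I_K}) (t : R) : R :=
  \sum_(j : J) (k j)%:R / K%:R * phi (val j) t.

Let sum_bound (a : J -> R) (b : R) : (forall j, `|a j| <= b) ->
  `|\sum_(j : J) a j| <= N%:R * b.
Proof.
move=> ab; apply: (le_trans (ler_norm_sum _ _ _)).
apply: (@le_trans _ _ (\sum_(j : J) b)); first by apply: ler_sum => j _.
by rewrite sumr_const -[leLHS]mulr_natl /N cardfE.
Qed.

Let F_bound k t : 0 <= F k t + N%:R < (N.*2.+1)%:R.
Proof.
have : `|F k t| <= N%:R * 1.
  apply: sum_bound => j; rewrite normrM -[leRHS]mul1r; apply: ler_pM => //.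
  by rewrite ger0_norm// ler_pdivrMr ?ltr0n// mul1r ler_nat ltnW.
rewrite mulr1 ler_norml => /andP[h1 h2].
rewrite -natr1 -addnn natrD; lra.
Qed.

(** [F_bound] keeps the integer part below 2 N + 1, so [inord] loses nothing. *)
Let cell (k : {ffun J -> 'I_K}) : {ffun 'I_M.+1 -> 'I_N.*2.+1} :=
  [ffun m => inord (Num.truncn (F k (node m) + N%:R))].

Let same_cell k k' m : cell k = cell k' -> `|F k (node m) - F k' (node m)| < 1.
Proof.
move=> /ffunP/(_ m); rewrite !ffunE => /(congr1 val) /=.
have b l : (Num.truncn (F l (node m) + N%:R) < N.*2.+1)%N.
  have /andP[h1 h2] := F_bound l (node m).
  by rewrite -(ltr_nat R); apply: le_lt_trans h2; have /andP[] := natr_trunc_bounds h1.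
rewrite !inordK//.
have /andP[/natr_trunc_bounds /andP[h1 h2] _] := F_bound k (node m).
have /andP[/natr_trunc_bounds /andP[h3 h4] _] := F_bound k' (node m).
move=> e; rewrite e in h1 h2; rewrite ltr_norml; apply/andP; split; lra.
Qed.

(** The coefficient vectors [k] of [S] share the integer parts of their sums at the
    M + 1 sample points m L / M.  Subtracting one of them, [k0], leaves sums that
    are smaller than 1 at these points; the two other terms of the bound pay for
    perturbing each coefficient by less than 1/K and for moving from t to the
    nearest sample point on its left. *)
Lemma many_small_combinations : exists (S : {set {ffun J -> 'I_K}}) k0,
  (K ^ N <= #|S| * (N.*2.+1) ^ M.+1)%N /\
  forall k, k \in S -> forall (v : J -> R),
    (forall j, offset k k0 j <= v j < offset k k0 j + K%:R^-1) ->
    forall t, 0 <= t <= L ->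
    `|\sum_(j : J) v j * phi (val j) t| <=
      1 + N%:R / K%:R + N%:R * (lip * (L / M%:R)).
Proof.
pose z : {ffun J -> 'I_K} := [ffun=> Ordinal K0].
have [u hu] := pigeonhole_fibre cell z.
pose S := [set k | cell k == u]%SET; exists S.
have hS : (K ^ N <= #|S| * (N.*2.+1) ^ M.+1)%N.
  by move: hu; rewrite !card_ffun !card_ord -cardfE.
have /card_gt0P[k0 k0S] : (0 < #|S|)%N.
  by rewrite -(@ltn_pmul2r (N.*2.+1 ^ M.+1)) ?expn_gt0// mul0n
    (leq_trans _ hS)// expn_gt0 K0.
exists k0; split=> // k kS v hv t /andP[t0 tL].
have ck : cell k = cell k0.
  by move: kS k0S; rewrite !inE => /eqP -> /eqP ->.
have Mr : 0 < M%:R :> R by rewrite ltr0n.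
have Kr : 0 < K%:R :> R by rewrite ltr0n.
have x0 : 0 <= t / (L / M%:R) by rewrite !divr_ge0// ltW.
have /andP[b1 b2] := natr_trunc_bounds x0.
have LM : 0 < L / M%:R by rewrite divr_gt0.
have mM : (Num.truncn (t / (L / M%:R)) < M.+1)%N.
  rewrite -(ltr_nat R) (le_lt_trans b1)// ltr_pdivrMr//.
  rewrite -natr1 mulrDl mul1r mulrCA mulfV ?gt_eqF// mulr1 (le_lt_trans tL)//.
  by rewrite ltrDl.
pose m : 'I_M.+1 := Ordinal mM.
have tm : `|t - node m| <= L / M%:R.
  move: b1 b2; rewrite ler_pdivlMr// ltr_pdivrMr// mulrDl mul1r => b1 b2.
  rewrite ger0_norm /node /=; lra.
have v1 j : `|v j| <= 1 by exact: offset_bound (hv j).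
pose dv j := v j - offset k k0 j.
have dv1 j : `|dv j| <= K%:R^-1.
  by have /andP[h1 h2] := hv j; rewrite /dv ger0_norm; lra.
(* value at the sample point, perturbation of the coefficients, change of t *)
have -> : \sum_(j : J) v j * phi (val j) t =
    (F k (node m) - F k0 (node m)) + \sum_(j : J) dv j * phi (val j) (node m)
    + \sum_(j : J) v j * (phi (val j) t - phi (val j) (node m)).
  rewrite /F -sumrB -!big_split /=; apply: eq_bigr => j _.
  rewrite /dv /offset; ring.
apply: (le_trans (ler_normD _ _)); apply: lerD; last first.
  apply: sum_bound => j; rewrite normrM -[leRHS]mul1r; apply: ler_pM => //.
  by apply: (le_trans (phi_lip _ _ _)); rewrite ler_wpM2l.
apply: (le_trans (ler_normD _ _)); apply: lerD; first exact/ltW/same_cell.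
apply: sum_bound => j; rewrite normrM -[leRHS]mulr1; exact: ler_pM.
Qed.

End pigeonhole.

(** * Measurability of the event without zeroes *)

(** By compactness a nonnegative continuous function without zeroes on [0, L] is
    bounded below by some 1/(n+1), and by continuity such a bound need only be
    tested at rationals.  Retracting the line onto [0, L] makes the rationals
    suffice also near the endpoints. *)
Lemma measurable_no_zero {R : realType} {d : measure_display}
    {T : measurableType d} (g : R -> T -> R) (L : R) : 0 < L ->
  (forall t w, 0 <= g t w) -> (forall w, continuous (g^~ w)) ->
  (forall t, measurable_fun setT (g t)) ->
  measurable [set w | forall t, 0 <= t <= L -> g t w != 0].
Proof.
move=> L0 g0 cg mg.
pose clamp (t : R) : R := Num.max 0 (Num.min t L).
have clampI t : 0 <= clamp t <= L.
  rewrite /clamp le_max lexx /= ge_max (ltW L0)/=.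
  by rewrite ge_min lexx orbT.
have clampE t : 0 <= t <= L -> clamp t = t.
  by move=> /andP[t0 tL]; rewrite /clamp min_l// max_r.
have cclamp : continuous clamp.
  move=> t; apply: (@continuous_max R R (cst 0) (fun s : R => Num.min s L)).
    exact: cvg_cst.
  by apply: (@continuous_min R R id (cst L)); [exact: cvg_id|exact: cvg_cst].
have -> : [set w | forall t, 0 <= t <= L -> g t w != 0] =
    \bigcup_n ~` \bigcup_(q : rat) [set w | g (clamp (ratr q)) w < n.+1%:R^-1].
  apply/seteqP; split=> [w gw|w [n _ gn] t tL].
    have [c cL cmin] : exists2 c, c \in `[0, L] &
        forall t, t \in `[0, L] -> g c w <= g t w.
      apply: EVT_min; first exact: ltW.
      exact/continuous_subspaceT/cg.
    have gc : 0 < g c w by rewrite lt_neqAle g0 eq_sym gw// -in_itv.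
    exists (Num.truncn (g c w)^-1) => //; case=> q _ /=; apply/negP; rewrite -leNgt.
    apply: le_trans (cmin _ _); last by rewrite in_itv/= clampI.
    rewrite -[leRHS]invrK lef_pV2 ?posrE ?invr_gt0 ?ltr0n//.
    by apply/ltW/truncnS_gt.
  apply/negP => /eqP gt0.
  pose O := [set s | g (clamp s) w < n.+1%:R^-1].
  have oO : open O.
    apply: (@open_comp _ _ (fun s => g (clamp s) w) [set x | x < n.+1%:R^-1]).
      by move=> s _; apply: (@continuous_comp R R R clamp (g^~ w)); [exact: cclamp|exact: cg].
    exact: open_lt.
  have O0 : O !=set0.
    by exists t; rewrite /O /= clampE// gt0 invr_gt0 ltr0n.
  have [s [Os [q _ qs]]] := dense_rat O0 oO.
  by apply: gn; exists q => //=; rewrite qs.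
apply: bigcup_measurable => n _; apply: measurableC.
apply: bigcupT_measurable_rat => q.
rewrite -[X in measurable X]setTI.
have := @measurable_fun_ltr _ _ _ setT (g (clamp (ratr q))) (cst n.+1%:R^-1)
  (mg _) (measurable_cst _) measurableT [set true] I.
by rewrite preimage_true.
Qed.

Lemma sum_Complex {R : realType} (I : Type) (s : seq I) (a b : I -> R) :
  \sum_(i <- s) Complex (a i) (b i) =
  Complex (\sum_(i <- s) a i) (\sum_(i <- s) b i).
Proof.
elim: s => [|i s IH]; first by rewrite !big_nil.
by rewrite !big_cons IH.
Qed.

Section wave.
Context {R : realType} {d : measure_display} {T : measurableType d}.
Variable P : probability T R.
Variables (u : R) (m : nat) (X Y : int * int -> {RV P >-> R}).

Definition freq (l : int * int) : R := 2 * pi * dotp (scaled m l) (dir u).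

Definition wave_re (t : R) (w : T) : R :=
  \sum_(l <- fset_set (Lambda m))
    (X l w * cos (freq l * t) - Y l w * sin (freq l * t)).

Definition wave_im (t : R) (w : T) : R :=
  \sum_(l <- fset_set (Lambda m))
    (X l w * sin (freq l * t) + Y l w * cos (freq l * t)).

Lemma Psi_eq0 (t : R) (w : T) : (0 < r2 m)%N ->
  Psi m X Y (t * (dir u).1, t * (dir u).2) w = 0 <->
  wave_re t w ^+ 2 + wave_im t w ^+ 2 = 0.
Proof.
move=> r0.
have s0 : (Num.sqrt (r2 m)%:R)^-1 != 0 :> R.
  by rewrite invr_eq0 gt_eqF// sqrtr_gt0 ltr0n.
have -> : Psi m X Y (t * (dir u).1, t * (dir u).2) w =
    Complex (Num.sqrt (r2 m)%:R)^-1 0 * Complex (wave_re t w) (wave_im t w).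
  rewrite /Psi fsbig_finite; last exact: finite_Lambda.
  congr (_ * _); rewrite -sum_Complex; apply: eq_bigr => l _.
  have -> : 2 * pi * dotp (scaled m l) (t * (dir u).1, t * (dir u).2) = freq l * t.
    rewrite /freq /dotp /=; ring.
  by rewrite /expi /= /GRing.mul /=.
split=> [/eqP|/eqP].
  rewrite mulf_eq0 => /orP[|] /eqP [] => [/eqP|-> ->]; last by rewrite expr0n addr0.
  by rewrite (negbTE s0).
by rewrite paddr_eq0 ?sqr_ge0// !sqrf_eq0 => /andP[/eqP-> /eqP->]; rewrite mulr0.
Qed.

Lemma continuous_wave (w : T) :
  continuous (fun t => wave_re t w ^+ 2 + wave_im t w ^+ 2).
Proof.
have cc l : continuous (fun t => cos (freq l * t)).
  move=> t; apply: continuous_comp; last exact: continuous_cos.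
  by apply: cvgM; [exact: cvg_cst|exact: cvg_id].
have cs l : continuous (fun t => sin (freq l * t)).
  move=> t; apply: continuous_comp; last exact: continuous_sin.
  by apply: cvgM; [exact: cvg_cst|exact: cvg_id].
have cre : continuous (wave_re ^~ w).
  apply: continuous_big => [|l _ t]; first exact: add_continuous.
  by apply: cvgB; apply: cvgM; [exact: cvg_cst|exact: cc|exact: cvg_cst|exact: cs].
have cim : continuous (wave_im ^~ w).
  apply: continuous_big => [|l _ t]; first exact: add_continuous.
  by apply: cvgD; apply: cvgM; [exact: cvg_cst|exact: cs|exact: cvg_cst|exact: cc].
by move=> t; apply: cvgD; apply: cvgM; [exact: cre..|exact: cim|exact: cim].
Qed.

Lemma measurable_wave (t : R) :
  measurable_fun setT (fun w => wave_re t w ^+ 2 + wave_im t w ^+ 2).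
Proof.
apply: measurable_funD; apply: measurable_funX; apply: measurable_sum => l.
  by apply: measurable_funB; apply: measurable_funM.
by apply: measurable_funD; apply: measurable_funM.
Qed.

(** Monotonicity of [P] needs both events to be measurable, whence the detour by
    the squared modulus, which is continuous in t. *)
Lemma prob_no_zero_ge (L : R) (E : set T) : 0 < L -> (0 < r2 m)%N ->
  measurable E ->
  (forall w, E w -> forall t, 0 <= t <= L -> wave_re t w != 0) ->
  (P E <= prob_no_zero P u m L X Y)%E.
Proof.
move=> L0 r0 mE Ere; rewrite /prob_no_zero.
have -> : [set w | nb_zeroes u m L X Y w = 0%E] =
  [set w | forall t, 0 <= t <= L -> wave_re t w ^+ 2 + wave_im t w ^+ 2 != 0].
  apply/seteqP; split=> w /=; rewrite /nb_zeroes /counting.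
    case: ifPn => // /asboolP fin [] /eqP; rewrite pnatr_eq0 cardfs_eq0 => /eqP.
    move=> A0 t tL; apply/eqP => /(Psi_eq0 _ _ r0) Pt.
    have : t \in fset_set [set t : R | t \in `[0, L] /\
        Psi m X Y (t * (dir u).1, t * (dir u).2) w = 0].
      by rewrite in_fset_set// inE /= in_itv.
    by rewrite A0.
  move=> gw; rewrite (_ : [set t | _] = set0).
    by rewrite fset_set0 cardfs0; case: ifPn => // /asboolP [].
  apply/seteqP; split=> t //= [tL /(Psi_eq0 _ _ r0) Pt].
  by move: tL; rewrite in_itv/= => /gw; rewrite Pt eqxx.
apply: le_measure; rewrite ?inE//.
  apply: measurable_no_zero => //.
  - by move=> t w; rewrite addr_ge0// sqr_ge0.
  - exact: continuous_wave.
  - exact: measurable_wave.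
move=> w /Ere Ew t tL; rewrite paddr_eq0 ?sqr_ge0// !sqrf_eq0.
by rewrite (negbTE (Ew t tL)).
Qed.

End wave.

(** * The wave along a segment in a lattice direction *)

Lemma derivative_bound1 {R : realType} (f df : R -> R) :
  (forall x : R, is_derive x 1 f (df x)) -> (forall x, `|df x| <= 1) ->
  forall x y, `|f x - f y| <= `|x - y|.
Proof.
move=> fdf df1 x y; wlog xy : x y / y <= x.
  move=> h; have [/h//|/ltW /h] := leP y x.
  by rewrite distrC (distrC y).
have [c _ ->] : exists2 c, c \in `[y, x] & f x - f y = df c * (x - y).
  apply: MVT_segment => // z; apply: continuous_subspaceT => {}z.
  apply: differentiable_continuous; apply/derivable1_diffP.
  by have [] := fdf z.
by rewrite normrM ler_piMl.
Qed.

Lemma point_mass_frequency {R : realType} (m : nat) (p : R * R) :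
  has_point_mass (spectral_measure m) p ->
  exists2 l, Lambda m l & scaled m l = p.
Proof.
rewrite /has_point_mass /spectral_measure => mass.
apply: contrapT => no; move: mass.
have -> : (\sum_(l \in Lambda m) (\d_(scaled m l) [set p] : \bar R))%E = 0%E.
  apply: fsbig1 => l lL; rewrite diracE memNset//= => sl.
  by apply: no; exists l.
by rewrite mule0 ltxx.
Qed.

(** A choice of one element in each pair of opposite lattice points. *)
Definition positive (l : int * int) : bool :=
  (0 < l.1) || ((l.1 == 0) && (0 < l.2)).

Lemma positiveN (m : nat) (l : int * int) : (0 < m)%N -> Lambda m l ->
  positive (- l) = ~~ positive l.
Proof.
case: l => x y m0; rewrite /Lambda /positive /= => h.
have : (x != 0) || (y != 0).
  apply/negPn/negP; rewrite negb_or !negbK => /andP[/eqP x0 /eqP y0].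
  by move: h; rewrite x0 y0 expr0n /=; lia.
lia.
Qed.

Section wave_line.
Context {R : realType} {d : measure_display} {T : measurableType d}.
Variable P : probability T R.
Variables (u : R) (m : nat) (X Y : int * int -> {RV P >-> R}).
Hypotheses (m0 : (0 < m)%N) (cXY : wave_coefficients P m X Y).

Definition coef (i : (int * int) * bool) : {RV P >-> R} :=
  if i.2 then Y i.1 else X i.1.

Definition mode (i : (int * int) * bool) (t : R) : R :=
  if i.2 then - sin (freq u m i.1 * t) else cos (freq u m i.1 * t).

Lemma mode_le1 i t : `|mode i t| <= 1.
Proof.
rewrite /mode; case: i.2; rewrite ?normrN ler_norml.
  by rewrite sin_geN1 sin_le1.
by rewrite cos_geN1 cos_le1.
Qed.

(** The dot product of two unit vectors is at most 1, and 2 pi < 8. *)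
Lemma freq_le8 l : Lambda m l -> `|freq u m l| <= 8.
Proof.
move=> lL.
have mr : 0 < m%:R :> R by rewrite ltr0n.
have s0 : Num.sqrt m%:R != 0 :> R by rewrite gt_eqF// sqrtr_gt0.
have unit_norm : (scaled m l).1 ^+ 2 + (scaled m l).2 ^+ 2 = 1 :> R.
  rewrite /scaled /= !expr_div_n -mulrDl sqr_sqrtr ?ltW//.
  rewrite -!rmorphXn -rmorphD /= [X in X%:~R](lL : _ = _).
  by rewrite mulfV// gt_eqF.
have d1 : `|dotp (scaled m l) (dir u)| <= 1.
  rewrite -(@ler_pXn2r _ 2)// ?nnegrE// expr1n real_normK ?num_real//.
  rewrite /dotp -[(dir u).1]/(cos u) -[(dir u).2]/(sin u); move: unit_norm (cos2Dsin2 u).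
  move: (scaled m l).1 (scaled m l).2 (cos u) (sin u) => a b c s h1 h2.
  have : 0 <= (a * s - b * c) ^+ 2 by exact: sqr_ge0.
  have : (a * c + b * s) ^+ 2 + (a * s - b * c) ^+ 2 = 1.
    by rewrite -[RHS]mulr1 -{1}h1 -h2; ring.
  lra.
rewrite /freq normrM -[8]mulr1; apply: ler_pM => //.
rewrite normrM !ger0_norm ?pi_ge0//.
have := @pihalf_lt2 R; lra.
Qed.

Lemma mode_lipschitz i s t : Lambda m i.1 ->
  `|mode i s - mode i t| <= 8 * `|s - t|.
Proof.
move=> iL; have lem : `|freq u m i.1 * s - freq u m i.1 * t| <= 8 * `|s - t|.
  by rewrite -mulrBr normrM ler_wpM2r// freq_le8.
apply: le_trans lem; rewrite /mode; case: i.2.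
  rewrite -opprD normrN; apply: (@derivative_bound1 _ _ cos) => x.
  by rewrite ler_norml cos_geN1 cos_le1.
apply: (@derivative_bound1 _ _ (fun x => - sin x)) => x.
by rewrite normrN ler_norml sin_geN1 sin_le1.
Qed.

Let HJ : seq ((int * int) * bool) :=
  [seq (l, b) | l <- [seq l <- fset_set (Lambda m) | positive l],
                b <- [:: false; true]].

Let HJ_uniq : uniq HJ.
Proof.
apply: allpairs_uniq => //; first by rewrite filter_uniq// fset_uniq.
by move=> [? ?] [? ?] _ _ [-> ->].
Qed.

Let mem_HJ i : i \in HJ = (i.1 \in fset_set (Lambda m)) && positive i.1.
Proof.
case: i => l b; apply/allpairsP/idP => [[[l' b'] /= []]|/= h].
  by rewrite mem_filter => /andP[p lL] _ [-> _]; rewrite lL.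
exists (l, b) => /=; rewrite mem_filter andbC h; split=> //.
by case: b.
Qed.

Let mem_Lambda l : l \in fset_set (Lambda m) = `[< Lambda m l >].
Proof. by rewrite in_fset_set//; exact: finite_Lambda. Qed.

Let LambdaN l : Lambda m (- l) <-> Lambda m l.
Proof. by case: l => x y; rewrite /Lambda /= !sqrrN. Qed.

Let size_HJ : (size HJ <= r2 m)%N.
Proof.
pose f (i : (int * int) * bool) := if i.2 then i.1 else - i.1.
rewrite -(size_map f); apply: uniq_leq_size.
  rewrite map_inj_in_uniq// => -[l b] [l' b'].
  rewrite !mem_HJ !mem_Lambda /= => /andP[/asboolP lL pl] /andP[/asboolP lL' pl'].
  rewrite /f /=; case: b b' => -[] // e.
  - by rewrite e.
  - by have := positiveN m0 lL'; rewrite -e pl pl'.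
  - by have := positiveN m0 lL; rewrite e pl pl'.
  - by move/oppr_inj: e => ->.
move=> _ /mapP[[l b] lb ->]; move: lb.
rewrite mem_HJ mem_Lambda /= => /andP[/asboolP lL _].
rewrite mem_Lambda /f /=; apply/asboolP; case: b => //.
exact/LambdaN.
Qed.

(** Opposite frequencies contribute equally, by the symmetry of the coefficients. *)
Let wave_re_HJ t w : wave_re u m X Y t w =
  2 * \sum_(i <- HJ) coef i w * mode i t.
Proof.
pose F l := X l w * cos (freq u m l * t) - Y l w * sin (freq u m l * t).
have FN l : Lambda m l -> F (- l) = F l.
  move=> lL; have [hX hY] : X (- l) w = X l w /\ Y (- l) w = - Y l w.
    by have [] := coef_conj cXY lL w.
  have fN : freq u m (- l) = - freq u m l.
    by rewrite /freq /dotp /scaled /= !rmorphN /=; ring.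
  by rewrite /F hX hY fN mulNr cosN sinN mulrNN.
have -> : \sum_(i <- HJ) coef i w * mode i t =
    \sum_(l <- fset_set (Lambda m) | positive l) F l.
  rewrite big_allpairs big_filter; apply: eq_bigr => l _.
  by rewrite !big_cons big_nil /coef /mode /= addr0 mulrN.
rewrite /wave_re (bigID positive) /= mulr2n mulrDl mul1r; congr (_ + _).
rewrite (perm_big (map -%R (fset_set (Lambda m)))) /=; last first.
  apply: uniq_perm; rewrite ?(map_inj_uniq oppr_inj) ?fset_uniq// => l.
  rewrite mem_Lambda; apply/asboolP/mapP => [lL|[l' + ->]].
    exists (- l); rewrite ?opprK// mem_Lambda; apply/asboolP; exact/LambdaN.
  by rewrite mem_Lambda => /asboolP h; exact/LambdaN.
rewrite big_map big_seq_cond [RHS]big_seq_cond; apply: eq_big => l.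
  rewrite mem_Lambda; case: asboolP => //= lL.
  by rewrite (positiveN m0 lL) negbK.
by rewrite mem_Lambda => /andP[/asboolP lL _]; exact: FN.
Qed.

(** The quarter turn of the lattice point that carries the mass, or its opposite,
    is a positive lattice point of frequency 0; its cosine coefficient is the
    constant term [i0].  Positive lattice points are never opposite, so the
    remaining coefficients are independent of it and of each other. *)
Lemma wave_decomposition :
  has_point_mass (spectral_measure m) (dir u) ->
  exists (i0 : (int * int) * bool) (J : {fset (int * int) * bool}),
  [/\ i0 \notin J,
      mutually_independent [set` (i0 |` J)%fset] coef,
      (forall i, i \in (i0 |` J)%fset ->
         Lambda m i.1 /\ gaussian (1 / 2) (coef i)),
      (#|` J| < r2 m)%N &
      forall t w, wave_re u m X Y t w =
        2 * (coef i0 w + \sum_(j : J) coef (val j) w * mode (val j) t)].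
Proof.
move=> /point_mass_frequency[[a b] abL [au bu]].
pose l1 : int * int := (- b, a).
have l1L : Lambda m l1 by rewrite /Lambda /= sqrrN addrC.
have fl1 : freq u m l1 = 0.
  rewrite /freq /dotp /scaled /dir /= -au -bu rmorphN /=; ring.
have [l0 [l0L l0p fl0]] : exists l, [/\ Lambda m l, positive l & freq u m l = 0].
  have [p|np] := boolP (positive l1); first by exists l1.
  exists (- l1); split; [exact/LambdaN|by rewrite (positiveN m0 l1L)|].
  by move: fl1; rewrite /freq /dotp /scaled /= !rmorphN /=; lra.
pose i0 := (l0, false).
have i0H : i0 \in HJ by rewrite mem_HJ /= mem_Lambda l0p andbT; exact/asboolP.
pose J := [fset i in HJ | i != i0]%fset.
have JE : (i0 |` J = [fset i in HJ])%fset.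
  apply/fsetP => i; rewrite !inE /=; case: eqP => [->|] //=; by rewrite andbT.
have memJ i : i \in (i0 |` J)%fset -> Lambda m i.1 /\ positive i.1.
  rewrite JE !inE /= mem_HJ mem_Lambda => /andP[/asboolP]; by split.
exists i0, J; split.
- by rewrite !inE /= eqxx andbF.
- have /(_ [set l | Lambda m l /\ positive l]) := coef_indep cXY.
  move=> ind K B KJ mB; apply: ind => //.
  + by move=> l [].
  + by move=> l [lL pl] [_]; rewrite (positiveN m0 lL) pl.
  + by move=> i /KJ /= /memJ [h1 h2]; split.
- move=> i /memJ [iL _]; split=> //; rewrite /coef.
  by case: i.2; [exact: (coef_im cXY)|exact: (coef_re cXY)].
- have : #|` (i0 |` J)%fset| = size HJ.
    rewrite JE; apply/perm_size/uniq_perm; rewrite ?fset_uniq// => i.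
    by rewrite !inE.
  rewrite cardfsU1 !inE /= eqxx andbF /= add1n => sz.
  by apply: leq_trans size_HJ; rewrite -sz.
move=> t w; rewrite wave_re_HJ; congr (_ * _).
have -> : \sum_(i <- HJ) coef i w * mode i t =
    \sum_(i <- (i0 |` J)%fset) coef i w * mode i t.
  apply: perm_big; apply: uniq_perm; rewrite ?fset_uniq// => i.
  by rewrite JE !inE.
rewrite big_fsetU1 /=; last by rewrite !inE /= eqxx andbF.
congr (_ + _); last by rewrite big_seq_fsetE.
by rewrite /mode /= fl0 mul0r cos0 mulr1.
Qed.

End wave_line.

(** * Lower bounds for the probability of no zero *)

(** With q = (r+1)^2 and r the integer fourth root of n, the exponent of 2 on the
    left is O(l r^3), which is below r^4 once r is large in terms of l. *)
Lemma grid_scale (l : nat) : exists n0 : nat, forall n : nat, (n0 <= n)%N ->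
  exists q : nat, [/\ (0 < q)%N, (n <= q ^ 2)%N, (q ^ 2 <= 16 * n)%N &
    (n.*2.+1 ^ (l * q).+1 <= 2 ^ n)%N].
Proof.
pose r0 := (5 * (4 * l).+1)%N; exists (r0 ^ 4)%N => n n0.
have ex : exists r, (r ^ 4 <= n)%N by exists r0.
have ub r : (r ^ 4 <= n)%N -> (r <= n)%N.
  by apply: leq_trans; case: r => // r; rewrite -{1}(expn1 r.+1) leq_pexp2l.
have [r rn rmax] := ex_maxnP ex ub.
have r0r : (r0 <= r)%N := rmax _ n0.
have nr : (n < r.+1 ^ 4)%N.
  by rewrite ltnNge; apply/negP => /rmax; rewrite ltnn.
have r1 : (0 < r)%N by rewrite (leq_trans _ r0r)// /r0; lia.
exists (r.+1 ^ 2)%N; split.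
- by rewrite expn_gt0.
- by rewrite -expnM ltnW.
- rewrite -expnM; apply: (@leq_trans ((2 * r) ^ 4)); first by rewrite leq_exp2r//; lia.
  by rewrite expnMn leq_mul2l.
have base : (n.*2.+1 <= 2 ^ (1 + 4 * r))%N.
  apply: (@leq_trans (2 * r.+1 ^ 4)); first by move: (r.+1 ^ 4)%N nr => s; lia.
  by rewrite expnD leq_mul// mulnC expnM leq_exp2r// ltn_expl.
apply: (@leq_trans ((2 ^ (1 + 4 * r)) ^ (l * r.+1 ^ 2).+1)); first by rewrite leq_exp2r.
rewrite -expnM leq_exp2l//; apply: leq_trans rn.
apply: (@leq_trans (5 * r * ((4 * l).+1 * r ^ 2))).
  apply: leq_mul; first by lia.
  have : (r.+1 ^ 2 <= 4 * r ^ 2)%N by nia.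
  have : (1 <= r ^ 2)%N by rewrite expn_gt0 r1.
  move: (r.+1 ^ 2)%N (r ^ 2)%N => s t; nia.
have -> : (5 * r * ((4 * l).+1 * r ^ 2) = r0 * r ^ 3)%N by rewrite /r0; nia.
by rewrite (expnS r 3) leq_mul2r r0r orbT.
Qed.

Section hole_probability.
Context {R : realType} {d : measure_display} {T : measurableType d}.
Variable P : probability T R.
Variables (u : R) (m : nat) (X Y : int * int -> {RV P >-> R}).
Hypotheses (m0 : (0 < m)%N) (cXY : wave_coefficients P m X Y).
Hypothesis mass : has_point_mass (spectral_measure m) (dir u).

(** All the cosines and sines are bounded by 1 on the whole line, so a single box
    serves for every L. *)
Lemma prob_no_zero_uniform : exists2 c : R, 0 < c &
  forall L, 0 < L -> (c%:E <= prob_no_zero P u m L X Y)%E.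
Proof.
have [i0 [J [i0J ind gV Jr dec]]] := wave_decomposition m0 cXY mass.
pose K := #|` J|.+1.
pose k0 : {ffun J -> 'I_K} := [ffun=> ord0].
have gV2 i : i \in (i0 |` J)%fset -> gaussian (1 / 2) (coef X Y i).
  by move=> /gV[].
have [E [mE Ebox PE]] := prob_boxes ind i0J gV2 [set k0]%SET k0 (ltn0Sn _) ler01.
eexists; last first.
  move=> L L0; apply: le_trans (prob_no_zero_ge L0 _ mE _); first exact: PE.
    exact: leq_ltn_trans Jr.
  move=> w /Ebox[k]; rewrite inE => /eqP -> [V1 VJ] t _.
  rewrite dec mulf_neq0// gt_eqF//.
  have : `|\sum_(j : J) coef X Y (val j) w * mode u m (val j) t| <=
      \sum_(j : J) K%:R^-1.
    apply: (le_trans (ler_norm_sum _ _ _)); apply: ler_sum => j _.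
    rewrite normrM -[leRHS]mulr1; apply: ler_pM => //; last exact: mode_le1.
    have := VJ j; rewrite /offset subrr mul0r add0r => /andP[v0 v1].
    by rewrite ger0_norm// ltW.
  rewrite sumr_const -cardfE -[leRHS]mulr_natl => h.
  have : #|` J|%:R * K%:R^-1 < 1 :> R.
    by rewrite ltr_pdivrMr ?ltr0n// mul1r ltr_nat.
  move: h; rewrite ler_norml => /andP[h _] h1; lra.
have p0 := @half_peak_gt0 R.
rewrite mulr_gt0 ?ltr0n ?cards1// mulr_gt0//; first by rewrite mulr_gt0 ?expR_gt0.
by rewrite exprn_gt0// divr_gt0 ?ltr0n// mulr_gt0 ?expR_gt0.
Qed.

(** With grid step 1/n and l q sample intervals, the three error terms of
    [many_small_combinations] are at most 1, 1 and q, so |f| <= 2 + q < 4 q, which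
    is where the box confines the constant term. *)
Lemma prob_no_zero_grid (L : R) (l q : nat) : 0 < L -> (0 < l)%N -> 8 * L <= l%:R ->
  (0 < q)%N -> (r2 m <= q ^ 2)%N ->
  ((r2 m).*2.+1 ^ (l * q).+1 <= 2 ^ r2 m)%N ->
  exists2 N, (N <= r2 m)%N &
  (((2 ^+ r2 m)^-1 * (half_peak * expR (- (4 * q%:R + 1) ^+ 2) *
      (half_peak * expR (- 1)) ^+ N))%:E <= prob_no_zero P u m L X Y)%E.
Proof.
move=> L0 l0 hl q0 rq hgrid.
have [i0 [J [i0J ind gV Jr dec]]] := wave_decomposition m0 cXY mass.
have r0 : (0 < r2 m)%N by exact: leq_ltn_trans Jr.
exists #|` J|; first exact: ltnW.
set n := r2 m in rq hgrid r0 Jr *; set N := #|` J| in Jr *.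
have gV2 i : i \in (i0 |` J)%fset -> gaussian (1 / 2) (coef X Y i).
  by move=> /gV[].
have lip (j : J) s t : `|mode u m (val j) s - mode u m (val j) t| <= 8 * `|s - t|.
  by apply: mode_lipschitz => //; have [] := gV (val j); rewrite // !inE fsvalP orbT.
have M0 : (0 < l * q)%N by rewrite muln_gt0 l0.
have [S [k0 [Sbig Ssmall]]] := many_small_combinations (ler0n R 8) L0 M0 r0
  (fun (j : J) t => mode_le1 u m (val j) t) lip.
have a0 : 0 <= 4 * q%:R :> R by rewrite mulr_ge0.
have [E [mE Ebox PE]] := prob_boxes ind i0J gV2 S k0 r0 a0.
apply: (@le_trans _ _ (P E)).
  apply: le_trans PE; rewrite lee_fin.
  have p0 : 0 < half_peak * expR (- 1) :> R by rewrite mulr_gt0 ?half_peak_gt0 ?expR_gt0.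
  have nr : 0 < n%:R :> R by rewrite ltr0n.
  rewrite expr_div_n [leRHS]mulrCA [leLHS]mulrCA.
  apply: ler_wpM2l; first by rewrite mulr_ge0 ?expR_ge0// ltW// half_peak_gt0.
  rewrite [leRHS]mulrCA [leRHS]mulrC; apply: ler_wpM2r; first by rewrite exprn_ge0// ltW.
  rewrite ler_pdivlMr ?exprn_gt0// ler_pdivrMl ?exprn_gt0//.
  rewrite -!natrX -natrM ler_nat mulnC (leq_trans Sbig)// leq_mul2l.
  apply/orP; right; apply: leq_trans hgrid; rewrite leq_exp2r// ltnS leq_double.
  exact: ltnW.
apply: prob_no_zero_ge => // w /Ebox[k kS [V0 VJ]] t tL.
rewrite dec mulf_neq0// gt_eqF//.
have := Ssmall k kS (fun j => coef X Y (val j) w) VJ t tL.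
have qr : 1 <= q%:R :> R by rewrite ler1n.
have nr : 0 < n%:R :> R by rewrite ltr0n.
have Nn : N%:R <= n%:R :> R by rewrite ler_nat ltnW.
have h1 : N%:R / n%:R <= 1 :> R by rewrite ler_pdivrMr// mul1r.
have h2 : N%:R * (8 * (L / (l * q)%:R)) <= q%:R :> R.
  have lq : 0 < (l * q)%:R :> R by rewrite ltr0n.
  have -> : N%:R * (8 * (L / (l * q)%:R)) = N%:R * (8 * L) / (l * q)%:R :> R by ring.
  rewrite ler_pdivrMr// (_ : q%:R * _ = (q ^ 2)%:R * l%:R); last first.
    by rewrite natrM natrX expr2 mulrCA mulrC.
  apply: ler_pM => //; first by rewrite mulr_ge0// ltW.
  by rewrite (le_trans Nn)// ler_nat.
rewrite ler_norml => /andP[h _]; lra.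
Qed.

End hole_probability.

(** Each of the factors 2^n, exp((4 q + 1)^2) and the N-th power is exp(O(n)),
    because N <= n and (4 q + 1)^2 <= 25 q^2 <= 400 n. *)
Lemma grid_constant {R : realType} : exists2 C0 : R, 0 < C0 &
  forall n N q : nat, (0 < n)%N -> (N <= n)%N -> (0 < q)%N -> (q ^ 2 <= 16 * n)%N ->
  expR (- (C0 * n%:R)) <= (2 ^+ n)^-1 * (half_peak * expR (- (4 * q%:R + 1) ^+ 2) *
      (half_peak * expR (- 1)) ^+ N).
Proof.
pose p : R := half_peak * expR (- 1).
have p0 : 0 < p by rewrite mulr_gt0 ?half_peak_gt0 ?expR_gt0.
pose b : R := Num.max 0 (- ln p).
have b0 : 0 <= b by rewrite /b le_max lexx.
have bp : expR (- b) <= p.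
  by rewrite -[leRHS]lnK ?posrE// ler_expR lerNl /b le_max lexx orbT.
exists (401 + 2 * b) => [|n N q n0 Nn q0 qn]; first lra.
have n1 : 1 <= n%:R :> R by rewrite ler1n.
have -> : - ((401 + 2 * b) * n%:R) =
    - n%:R + (- b * n%:R + - (400 * n%:R) + - b * n%:R) by ring.
rewrite !expRD; apply: ler_pM; rewrite ?expR_ge0 ?mulr_ge0 ?expR_ge0//.
  rewrite expRN lef_pV2 ?posrE ?exprn_gt0 ?expR_gt0//.
  rewrite -[n%:R]mulr1 expRM_natl; apply: lerXn2r; rewrite ?nnegrE ?expR_ge0//.
  by apply: le_trans (expR_ge1Dx 1); lra.
apply: ler_pM; rewrite ?expR_ge0 ?mulr_ge0 ?expR_ge0//.
  apply: ler_pM; rewrite ?expR_ge0//.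
    apply: (@le_trans _ _ (expR (- b))); first by rewrite ler_expR mulNr lerN2 ler_peMr.
    apply: (le_trans bp); apply: ler_piMr; first exact/ltW/half_peak_gt0.
    by rewrite expR_le1; lra.
  have qr : 1 <= q%:R :> R by rewrite ler1n.
  have : q%:R ^+ 2 <= 16 * n%:R :> R by rewrite -natrX -natrM ler_nat.
  rewrite ler_expR lerN2 !expr2 => h.
  have : q%:R * 1 <= q%:R * q%:R :> R by rewrite ler_wpM2l.
  have : 1 * 1 <= q%:R * q%:R :> R by rewrite ler_pM.
  lra.
apply: (@le_trans _ _ (expR (- b) ^+ N)).
  by rewrite -expRM_natr ler_expR !mulNr lerN2 ler_wpM2l// ler_nat.
by apply: lerXn2r; rewrite ?nnegrE ?expR_ge0// ltW.
Qed.

Lemma neg_lne_le {R : realType} (p : \bar R) (a : R) :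
  ((expR (- a))%:E <= p)%E -> (- lne p <= a%:E)%E.
Proof.
case: p => [p| |] //; rewrite ?lee_fin; last by rewrite leNye.
move=> ap.
have p0 : 0 < p by apply: lt_le_trans ap; exact: expR_gt0.
by rewrite lne_EFin// -EFinN lee_fin lerNl -[leLHS]expRK ler_ln ?posrE ?expR_gt0.
Qed.

Theorem proposition1p4 (R : realType) (d : measure_display)
    (T : measurableType d) (P : probability T R) (u : R)
    (hu : 0 <= u <= pi / 4) :
  (forall (m : nat) (X Y : int * int -> {RV P >-> R}),
      sum_of_two_squares m ->
      wave_coefficients P m X Y ->
      has_point_mass (spectral_measure m) (dir u) ->
      exists c : R, 0 < c /\
        forall L : R, 0 < L -> (c%:E <= prob_no_zero P u m L X Y)%E)
  /\
  (forall (m : nat -> nat) (X Y : nat -> int * int -> {RV P >-> R}),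
      (forall k, sum_of_two_squares (m k)) ->
      (forall k, wave_coefficients P (m k) (X k) (Y k)) ->
      (\forall k \near \oo, has_point_mass (spectral_measure (m k)) (dir u)) ->
      r2 (m k) @[k --> \oo] --> \oo ->
      forall eps : R, 0 < eps ->
      exists C1 C2 : R, forall L : R, 0 < L ->
      exists N : nat, forall k : nat, (N <= r2 (m k))%N ->
        (- lne (prob_no_zero P u (m k) L (X k) (Y k)) < (C1 * (r2 (m k))%:R)%:E)%E
        /\ C1 * (r2 (m k))%:R < C2 * (m k)%:R `^ eps).
Proof.
split=> [m X Y [m0 _] cXY mass|m X Y hm cXY [k1 _ mass] _ eps eps0].
  by have [c c0 hc] := prob_no_zero_uniform m0 cXY mass; exists c.
have [Ce Ce0 hCe] := r2_bound eps0.
have [C0 C00 hC0] := @grid_constant R.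
have C1 : 0 < C0 + 1 by rewrite addr_gt0.
exists (C0 + 1), ((C0 + 1) * Ce + 1) => L L0.
pose l := (Num.truncn (8 * L)).+1.
have hl : 8 * L <= l%:R by apply/ltW/truncnS_gt.
have [n0 hn0] := grid_scale l.
(* r2 (m k) beyond this maximum forces k to be past the first k1 indices *)
pose rmax := (\max_(k < k1) r2 (m k))%N.
exists (maxn n0 rmax.+1) => k; rewrite geq_max => /andP[n0k kmax].
have [mk0 _] := hm k.
have k1k : (k1 <= k)%N.
  rewrite leqNgt; apply/negP => kk1; move: kmax; rewrite ltnNge => /negP; apply.
  by rewrite /rmax (leq_bigmax (Ordinal kk1)).
have r0 : (0 < r2 (m k))%N by exact: leq_trans kmax.
have [q [q0 nq qn grid]] := hn0 _ n0k.
have [N Nn PN] := prob_no_zero_grid mk0 (cXY k) (mass _ k1k) L0 (ltn0Sn _) hl q0 nq grid.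
split.
  apply: (@le_lt_trans _ _ (C0 * (r2 (m k))%:R)%:E).
    by apply: neg_lne_le => //; apply: le_trans PN; rewrite lee_fin; exact: hC0.
  by rewrite lte_fin ltr_pM2r ?ltr0n// ltrDl.
apply: (@le_lt_trans _ _ ((C0 + 1) * Ce * (m k)%:R `^ eps)).
  by rewrite -mulrA ler_wpM2l ?hCe// ltW.
by rewrite ltr_pM2r ?powR_gt0 ?ltr0n// ltrDl.
Qed.
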